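(* Let $1\le k\le n$. Then $$d_{\mathrm{cb}}(H_n^k,H_n^1)=\sqrt{\frac{kn}{n-k+1}}.$$
   Context: Definition of $H_n^k$. Let $1\le k\le n$. Let $I=\{i_1<\cdots<i_{k-1}\}$ range over the subsets of $\{1,\ldots,n\}$ of cardinality $k-1$ (there are $q=\binom{n}{k-1}$ of them) and $J=\{j_1<\cdots<j_{n-k}\}$ over the subsets of cardinality $n-k$ (there are $p=\binom{n}{n-k}$ of them), each collection ordered lexicographically. Let $\{e_I\}$ and $\{e_J\}$ be the canonical bases of column vectors of $\mathbf{C}^q$ and $\mathbf{C}^p$, indexed by these subsets, and let $e_{J,I}=e_Je_I^t\in M_{p,q}(\mathbf{C})=B(\mathbf{C}^q,\mathbf{C}^p)$. For $1\le i\le n$ put $$b_i^{n,k}=\sum_{I\cap J=\emptyset,\ (I\cup J)^c=\{i\}}\epsilon(I,i,J)\,e_{J,I},$$ where $\epsilon(I,i,J)$ is the signature of the permutation taking $(i_1,\ldots,i_{k-1},i,j_1,\ldots,j_{n-k})$ to $(1,\ldots,n)$. Then $H_n^k$ is the linear span of $b_1^{n,k},\ldots,b_n^{n,k}$, with the operator space structure inherited from $B(\mathbf{C}^q,\mathbf{C}^p)$. In particular $H_n^1=B(\mathbf{C},\mathbf{C}^n)$ is the column Hilbert space $C_n$ and $H_n^n=B(\mathbf{C}^n,\mathbf{C})$ is the row Hilbert space $R_n$. The completely bounded Banach-Mazur distance between completely isomorphic operator spaces $E,F$ is $d_{\mathrm{cb}}(E,F)=\inf\{\|u\|_{\mathrm{cb}}\|u^{-1}\|_{\mathrm{cb}}\}$,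 the infimum being over all complete isomorphisms $u:E\to F$ (linear bijections with $u$ and $u^{-1}$ completely bounded). *)

(* Defs.v *)
From HB Require Import structures.
From mathcomp Require Import all_boot all_order all_algebra all_fingroup.
From mathcomp Require Import complex.
From mathcomp Require Import boolp classical_sets reals constructive_ereal ereal.

Set Implicit Arguments.
Unset Strict Implicit.
Unset Printing Implicit Defensive.

Import Order.TTheory GRing.Theory Num.Theory.
Local Open Scope ring_scope.
Local Open Scope complex_scope.

(* A concrete (finite-dimensional) operator space is a subspace
   E : {vspace 'M[R[i]]_(p, q)} of B(C^q, C^p), matrices acting on column
   vectors. *)
Section OperatorSpaces.
Local Open Scope classical_set_scope.
Variable R : realType.

Definition l2norm (q : nat) (x : 'cV[R[i]]_q) : R :=
  Num.sqrt (\sum_(i < q) ComplexField.Normc.normc (x i 0) ^+ 2).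

Definition opnorm (p q : nat) (A : 'M[R[i]]_(p, q)) : R :=
  sup [set l2norm (A *m x) | x in [set x : 'cV[R[i]]_q | l2norm x <= 1]].

(* The norm of M_m(E), inherited from
   M_m(B(C^q, C^p)) = B((C^q)^m, (C^p)^m). *)
Definition matnorm (p q : nat) (E : {vspace 'M[R[i]]_(p, q)}) (m : nat)
    (X : 'M[subvs_of E]_m) : R :=
  opnorm (mxblock (p_ := fun _ : 'I_m => p) (q_ := fun _ : 'I_m => q)
            (fun i j => vsval (X i j))).

Section Maps.
Variables (p q r s : nat).
Variables (E : {vspace 'M[R[i]]_(p, q)}) (F : {vspace 'M[R[i]]_(r, s)}).

(* map_mx u X is the amplification of u applied to X. *)
Definition amplnorm (m : nat) (u : 'Hom(subvs_of E, subvs_of F)) : \bar R :=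
  ereal_sup [set (matnorm (map_mx u X))%:E
            | X in [set X : 'M[subvs_of E]_m | matnorm X <= 1]].

Definition cbnorm (u : 'Hom(subvs_of E, subvs_of F)) : \bar R :=
  ereal_sup [set amplnorm m u | m in [set m : nat | (0 < m)%N]].

End Maps.

Definition dcb (p q r s : nat) (E : {vspace 'M[R[i]]_(p, q)})
    (F : {vspace 'M[R[i]]_(r, s)}) : \bar R :=
  ereal_inf [set d : \bar R |
    exists (u : 'Hom(subvs_of E, subvs_of F)) (v : 'Hom(subvs_of F, subvs_of E)),
      [/\ cancel u v, cancel v u, (cbnorm u < +oo)%E, (cbnorm v < +oo)%E
        & d = (cbnorm u * cbnorm v)%E]].

End OperatorSpaces.

(* {1, ..., n} is represented by 'I_n, shifted by one; enum A lists a set A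
   of ordinals in increasing order. *)
Section Hnk.
Variable n : nat.

Definition lexle (A B : {set 'I_n}) : bool :=
  ((enum A : seqlexi 'I_n) <= (enum B : seqlexi 'I_n))%O.

Definition lexsets (m : nat) : seq {set 'I_n} :=
  sort lexle (enum [set A : {set 'I_n} | #|A| == m]).

(* The signature of the permutation taking the word
   (i_1, ..., i_{k-1}, i, j_1, ..., j_{n-k}) to (1, ..., n). Such a permutation
   exists, and is unique, as soon as I, {i} and J partition 'I_n. *)
Definition eps (R : realType) (I : {set 'I_n}) (i : 'I_n) (J : {set 'I_n}) :
    R[i] :=
  if [pick s : 'S_n | map s (enum I ++ i :: enum J) == enum 'I_n] is Some s
  then (-1) ^+ s else 0.

Variables (R : realType) (k : nat).

(* Rows and columns are indexed by the ranks a, b of J, I in the lexicographic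
   enumerations; delta_mx a b is then e_{J,I}. *)
Definition bvec (i : 'I_n) : 'M[R[i]]_('C(n, n - k), 'C(n, k - 1)) :=
  let J a := nth finset.set0 (lexsets (n - k)) a in
  let I b := nth finset.set0 (lexsets (k - 1)) b in
  \sum_(a < 'C(n, n - k))
    \sum_(b < 'C(n, k - 1) | (I b :&: J a == finset.set0) &&
                             (~: (I b :|: J a) == [set i]))
      eps R (I b) i (J a) *: delta_mx a b.

Definition H : {vspace 'M[R[i]]_('C(n, n - k), 'C(n, k - 1))} :=
  <<[seq bvec i | i : 'I_n]>>%VS.

End Hnk.

(* Main.v *)
Require Import Defs.
From HB Require Import structures.
From mathcomp Require Import boolp classical_sets reals constructive_ereal ereal.
From mathcomp Require Import all_boot all_order all_algebra all_fingroup.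
From mathcomp Require Import complex ring zify.
Import Order.TTheory GRing.Theory Num.Theory.
Local Open Scope ring_scope.

Set Implicit Arguments.
Unset Strict Implicit.
Unset Printing Implicit Defensive.

(* The matrices b_i have entries 0 and +-1 and pairwise disjoint supports, each
   b_i has at most one nonzero entry per row and per column, and together they
   have k nonzero entries in each row, n-k+1 in each column, and
   g = C(n-1,k-1) each. Only these counts matter, never the signs.
   Upper bound, for u : b_i |-> e_i: summing the norms of T (xi (x) e_t) over t,
   for T = sum a_i (x) b_i, gives g |sum a_i^* a_i| <= q |T|^2, so
   |u|_cb^2 <= q/g = n/(n-k+1); a weighted Cauchy-Schwarz inequality gives
   |u^-1|_cb^2 <= k.
   Lower bound, for arbitrary u: test u on the column (b_1, ..., b_n), of norm at
   most sqrt (n-k+1), and u^-1 on the row (e_1, ..., e_n), of norm at most 1.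
   With U, V the matrices of u, u^-1 this gives
   |u|_cb^2 >= |U|_HS^2/(n-k+1) and |u^-1|_cb^2 >= (k/n) |V|_HS^2,
   and n = tr (U V) <= |U|_HS |V|_HS. *)

(** * Cauchy-Schwarz and the operator norm *)

Lemma sum_CauchySchwarz {R : realDomainType} (I : finType) (f g : I -> R) :
  (\sum_i f i * g i) ^+ 2 <= (\sum_i f i ^+ 2) * (\sum_i g i ^+ 2).
Proof.
suff : 0 <= 2%:R * ((\sum_i f i ^+ 2) * (\sum_i g i ^+ 2)
                    - (\sum_i f i * g i) ^+ 2).
  by rewrite pmulr_rge0 ?ltr0n// subr_ge0.
(* Lagrange's identity; the factor 2 comes from summing over ordered pairs (i, j). *)
suff -> : 2%:R * ((\sum_i f i ^+ 2) * (\sum_i g i ^+ 2)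
    - (\sum_i f i * g i) ^+ 2) = \sum_i \sum_j (f i * g j - f j * g i) ^+ 2.
  by apply: sumr_ge0 => i _; apply: sumr_ge0 => j _; exact: sqr_ge0.
transitivity (\sum_i \sum_j (f i ^+ 2 * g j ^+ 2 + g i ^+ 2 * f j ^+ 2
                             - (f i * g i) * (f j * g j) *+ 2)); last first.
  by apply: eq_bigr => i _; apply: eq_bigr => j _; ring.
under [RHS]eq_bigr => i _ do
  rewrite sumrB big_split /= sumrMnl -!mulr_sumr.
rewrite sumrB big_split /= sumrMnl -!mulr_suml.
by ring.
Qed.

Section OperatorNorm.
Variable R : realType.
Local Notation C := R[i].

Definition sqnormc (z : C) : R := ComplexField.Normc.normc z ^+ 2.

Lemma sqnormc_ge0 z : 0 <= sqnormc z.
Proof. exact: sqr_ge0. Qed.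

Lemma sqnormcM x y : sqnormc (x * y) = sqnormc x * sqnormc y.
Proof. by rewrite /sqnormc ComplexField.Normc.normcM exprMn. Qed.

Lemma sqnormc0 : sqnormc 0 = 0.
Proof. by rewrite /sqnormc ComplexField.Normc.normc0 expr0n. Qed.

Lemma sqnormc1 : sqnormc 1 = 1.
Proof. by rewrite /sqnormc ComplexField.Normc.normc1 expr1n. Qed.

Lemma sqnormc_real (r : R) : sqnormc r%:C%C = r ^+ 2.
Proof. by rewrite /sqnormc /= expr0n addr0 sqr_sqrtr// sqr_ge0. Qed.

Lemma sqnormc_conj z : z * conjc z = (sqnormc z)%:C%C.
Proof.
case: z => a b; rewrite /sqnormc /= sqr_sqrtr ?addr_ge0 ?sqr_ge0//.
by apply/eqP; rewrite eq_complex /=; apply/andP; split; apply/eqP; ring.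
Qed.

Lemma sqnormcJ z : sqnormc (conjc z) = sqnormc z.
Proof. by case: z => a b; rewrite /sqnormc /= sqrrN. Qed.

Lemma normc_ge0 (z : C) : 0 <= ComplexField.Normc.normc z.
Proof. by case: z => a b /=; exact: sqrtr_ge0. Qed.

Lemma normc_sum (I : finType) (f : I -> C) :
  ComplexField.Normc.normc (\sum_i f i)
  <= \sum_i ComplexField.Normc.normc (f i).
Proof.
elim/big_ind2: _ => [|x1 x2 y1 y2 h1 h2|//].
  by rewrite ComplexField.Normc.normc0.
by apply: le_trans (lerD h1 h2); exact: le_normcD.
Qed.

Lemma sqnormc_sum_le (I : finType) (f g : I -> C) :
  sqnormc (\sum_i f i * g i) <= (\sum_i sqnormc (f i)) * (\sum_i sqnormc (g i)).
Proof.
apply: le_trans (sum_CauchySchwarz _ _).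
rewrite /sqnormc ler_pXn2r ?nnegrE ?normc_ge0//; last first.
  by apply: sumr_ge0 => i _; rewrite mulr_ge0 ?normc_ge0.
apply: le_trans (normc_sum _) _.
by apply: ler_sum => i _; rewrite ComplexField.Normc.normcM.
Qed.

Definition sqnorm q (x : 'cV[C]_q) : R := \sum_i sqnormc (x i 0).

Lemma sqnorm_ge0 q (x : 'cV[C]_q) : 0 <= sqnorm x.
Proof. by apply: sumr_ge0 => i _; exact: sqnormc_ge0. Qed.

Lemma sqnorm0 q : sqnorm (0 : 'cV[C]_q) = 0.
Proof. by rewrite /sqnorm big1// => i _; rewrite mxE sqnormc0. Qed.

Lemma sqnormZ q c (x : 'cV[C]_q) : sqnorm (c *: x) = sqnormc c * sqnorm x.
Proof.
by rewrite /sqnorm mulr_sumr; apply: eq_bigr => i _; rewrite mxE sqnormcM.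
Qed.

Lemma sqr_l2norm q (x : 'cV[C]_q) : l2norm x ^+ 2 = sqnorm x.
Proof. by rewrite sqr_sqrtr// sqnorm_ge0. Qed.

Lemma l2norm_ge0 q (x : 'cV[C]_q) : 0 <= l2norm x.
Proof. exact: sqrtr_ge0. Qed.

Lemma l2norm_le1 q (x : 'cV[C]_q) : (l2norm x <= 1) = (sqnorm x <= 1).
Proof. by rewrite -sqr_l2norm expr_le1 ?l2norm_ge0. Qed.

Lemma sqnorm_eq0 q (x : 'cV[C]_q) : sqnorm x = 0 -> x = 0.
Proof.
move/psumr_eq0P => h; apply/matrixP => i j; rewrite ord1 mxE.
have /eqP := h (fun i _ => sqnormc_ge0 _) i isT.
by rewrite sqrf_eq0 => /eqP /ComplexField.Normc.eq0_normc.
Qed.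

Lemma sqnorm_mulmx_le p q (A : 'M[C]_(p, q)) x :
  sqnorm (A *m x) <= (\sum_a \sum_t sqnormc (A a t)) * sqnorm x.
Proof.
rewrite mulr_suml; apply: ler_sum => a _; rewrite mxE.
exact: sqnormc_sum_le.
Qed.

(** The Hilbert-Schmidt norm is a bound. This makes the [sup] in [opnorm] a genuine supremum rather
    than a default value. *)
Lemma opnorm_set_ubound p q (A : 'M[C]_(p, q)) :
  has_ubound [set l2norm (A *m x) | x in [set x : 'cV[C]_q | l2norm x <= 1]]%classic.
Proof.
exists (Num.sqrt (\sum_a \sum_t sqnormc (A a t))) => _ [x /= hx <-].
apply: ler_wsqrtr; apply: le_trans (sqnorm_mulmx_le A x) _.
rewrite ler_piMr -?l2norm_le1//.
by do 2!apply: sumr_ge0 => ? _; exact: sqnormc_ge0.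
Qed.

Lemma opnorm_ge0 p q (A : 'M[C]_(p, q)) : 0 <= opnorm A.
Proof.
apply: le_trans (l2norm_ge0 (A *m 0)) _.
apply: (ub_le_sup (opnorm_set_ubound A)); exists 0 => //=.
by rewrite l2norm_le1 sqnorm0 ler01.
Qed.

Lemma sqnorm_mulmx_le_opnorm p q (A : 'M[C]_(p, q)) x :
  sqnorm (A *m x) <= opnorm A ^+ 2 * sqnorm x.
Proof.
have [x0|x0] := eqVneq (sqnorm x) 0.
  by rewrite (sqnorm_eq0 x0) mulmx0 !sqnorm0 mulr0.
have xp : 0 < sqnorm x by rewrite lt_def x0 sqnorm_ge0.
rewrite -ler_pdivrMr//.
(* Scaling by [c] brings [x] to the unit sphere, where the supremum applies. *)
pose c := (Num.sqrt (sqnorm x))^-1.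
have c2 : c ^+ 2 = (sqnorm x)^-1 by rewrite exprVn sqr_sqrtr// ltW.
have -> : sqnorm (A *m x) / sqnorm x = sqnorm (A *m (c%:C%C *: x)).
  by rewrite -scalemxAr sqnormZ sqnormc_real c2 mulrC.
rewrite -sqr_l2norm ler_pXn2r ?nnegrE ?l2norm_ge0 ?opnorm_ge0//.
apply: (ub_le_sup (opnorm_set_ubound A)); exists (c%:C%C *: x) => //=.
by rewrite l2norm_le1 sqnormZ sqnormc_real c2 mulVf.
Qed.

Lemma sqr_opnorm_le p q (A : 'M[C]_(p, q)) c : 0 <= c ->
  (forall x, sqnorm (A *m x) <= c * sqnorm x) -> opnorm A ^+ 2 <= c.
Proof.
move=> c0 h; rewrite -(sqr_sqrtr c0) ler_pXn2r ?nnegrE ?sqrtr_ge0 ?opnorm_ge0//.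
apply: ge_sup.
  exists (l2norm (A *m 0)), 0 => //=.
  by rewrite l2norm_le1 sqnorm0 ler01.
move=> _ [x /= hx <-]; apply: ler_wsqrtr; apply: le_trans (h x) _.
by rewrite ler_piMr// -l2norm_le1.
Qed.

(** Block matrices are indexed by flattened pairs; this turns a flat sum into a sum over blocks and
    over positions inside a block. *)
Lemma big_tagnat (V : nmodType) m (d : 'I_m -> nat) (F : forall s, 'I_(d s) -> V) :
  \sum_(j < \sum_s d s) F (tagnat.sig1 j) (tagnat.sig2 j) =
  \sum_s \sum_t F s t.
Proof. by rewrite sig_big_dep (reindex _ tagnat.sig_bij_on). Qed.

(** * Norms of matrices over an operator space *)

Section MatNorm.
Variables (p q : nat) (E : {vspace 'M[C]_(p, q)}) (m : nat).
Implicit Type (X : 'M[subvs_of E]_m).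

(** Squared norm of the block matrix [X] applied to the vector with blocks [x s], in coordinates, so
    that later estimates avoid [mxblock]. *)
Definition blocksq X (x : 'I_m -> 'I_q -> C) : R :=
  \sum_r \sum_a sqnormc (\sum_s \sum_t vsval (X r s) a t * x s t).

Lemma sqnorm_mxblock X (x : 'I_m -> 'I_q -> C) :
  sqnorm (mxblock (p_ := fun _ : 'I_m => p) (q_ := fun _ : 'I_m => q)
            (fun i j => vsval (X i j)) *m
            mxcol (p_ := fun _ : 'I_m => q) (fun s => \col_t x s t)) = blocksq X x.
Proof.
rewrite /sqnorm /blocksq -(big_tagnat (d := fun=> p)); apply: eq_bigr => j _.
rewrite mxE -(big_tagnat (d := fun=> q)); congr sqnormc; apply: eq_bigr => i _.
by rewrite !mxE.
Qed.

Lemma sqnorm_mxcol (x : 'I_m -> 'I_q -> C) :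
  sqnorm (mxcol (p_ := fun _ : 'I_m => q) (fun s => \col_t x s t)) =
  \sum_s \sum_t sqnormc (x s t).
Proof.
rewrite /sqnorm -(big_tagnat (d := fun=> q)); apply: eq_bigr => j _.
by rewrite !mxE.
Qed.

Lemma matnorm_ge0 X : 0 <= matnorm X.
Proof. exact: opnorm_ge0. Qed.

Lemma blocksq_le X x :
  blocksq X x <= matnorm X ^+ 2 * \sum_s \sum_t sqnormc (x s t).
Proof.
by rewrite -sqnorm_mxblock -sqnorm_mxcol; exact: sqnorm_mulmx_le_opnorm.
Qed.

Lemma sqr_matnorm_le X c : 0 <= c ->
  (forall x, blocksq X x <= c * \sum_s \sum_t sqnormc (x s t)) ->
  matnorm X ^+ 2 <= c.
Proof.
move=> c0 h; apply: sqr_opnorm_le => // x.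
have -> : x = mxcol (p_ := fun _ : 'I_m => q)
                (fun s => \col_t x (tagnat.Rank (p_ := fun=> q) s t) 0).
  apply/matrixP => j k; rewrite !mxE ord1 tagnat.sig2K //.
by rewrite sqnorm_mxblock sqnorm_mxcol.
Qed.

(** Test [X] on the conjugate of its own row (r, a): that coordinate of the image is the sum S
    itself, so S^2 <= |X|^2 S. *)
Lemma matnorm_row X r a :
  \sum_s \sum_t sqnormc (vsval (X r s) a t) <= matnorm X ^+ 2.
Proof.
set S := (X in X <= _).
have S0 : 0 <= S by do 2!apply: sumr_ge0 => ? _; exact: sqnormc_ge0.
have [->|Sn] := eqVneq S 0; first exact: sqr_ge0.
have Sp : 0 < S by rewrite lt_def Sn.
rewrite -(ler_pM2r Sp).
have -> : matnorm X ^+ 2 * S = matnorm X ^+ 2 *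
    \sum_s \sum_t sqnormc (conjc (vsval (X r s) a t)).
  by congr (_ * _); apply: eq_bigr => s _; apply: eq_bigr => t _; rewrite sqnormcJ.
apply: le_trans (blocksq_le _ _).
rewrite /blocksq (bigD1 r)//= (bigD1 a)//= -addrA.
have -> : \sum_s \sum_t vsval (X r s) a t * conjc (vsval (X r s) a t) = S%:C%C.
  rewrite /S rmorph_sum /=; apply: eq_bigr => s _; rewrite rmorph_sum /=.
  by apply: eq_bigr => t _; rewrite sqnormc_conj.
rewrite sqnormc_real expr2 lerDl addr_ge0//.
  by apply: sumr_ge0 => ? _; exact: sqnormc_ge0.
by do 2!apply: sumr_ge0 => ? _; exact: sqnormc_ge0.
Qed.

(** Test [X] on the basis vector (s, t). *)
Lemma matnorm_col X s t :
  \sum_r \sum_a sqnormc (vsval (X r s) a t) <= matnorm X ^+ 2.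
Proof.
have := blocksq_le X (fun s' t' => ((s' == s) && (t' == t))%:R).
have sum1 (V : nmodType) (f : 'I_m -> 'I_q -> V) :
    (forall s' t', ~~ ((s' == s) && (t' == t)) -> f s' t' = 0) ->
    \sum_s' \sum_t' f s' t' = f s t.
  move=> f0; rewrite (bigD1 s)//= (bigD1 t)//= !big1 ?addr0// => [s' ns|t' nt].
    by apply: big1 => t' _; rewrite f0// (negPf ns).
  by rewrite f0// (negPf nt) andbF.
rewrite (sum1 R) => [|s' t' /negPf ->]; last by rewrite sqnormc0.
rewrite !eqxx sqnormc1 mulr1; apply: le_trans.
apply: ler_sum => r _; apply: ler_sum => a _.
rewrite sum1 => [|s' t' /negPf ->]; last by rewrite mulr0.
by rewrite !eqxx mulr1.
Qed.

End MatNorm.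

(** * Completely bounded norms *)

Section CbNorm.
Variables (p q r s : nat).
Variables (E : {vspace 'M[C]_(p, q)}) (F : {vspace 'M[C]_(r, s)}).
Implicit Type (u : 'Hom(subvs_of E, subvs_of F)).

Lemma cbnorm_ge u m (X : 'M[subvs_of E]_m) : (0 < m)%N -> matnorm X <= 1 ->
  ((matnorm (map_mx u X))%:E <= cbnorm u)%E.
Proof.
move=> m0 hX; apply: (@le_trans _ _ (amplnorm m u)).
  by apply: ereal_sup_ubound; exists X.
by apply: ereal_sup_ubound; exists m.
Qed.

Lemma cbnorm_le u c :
  (forall m (X : 'M[subvs_of E]_m), matnorm X <= 1 -> matnorm (map_mx u X) <= c) ->
  (cbnorm u <= c%:E)%E.
Proof.
move=> h; apply: ge_ereal_sup => _ [m m0 <-]; apply: ge_ereal_sup => _ [X hX <-].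
by rewrite lee_fin; exact: h.
Qed.

Lemma cbnorm_ge0 u : (0 <= cbnorm u)%E.
Proof.
(* The zero matrix of size 1 lies in the unit ball, so the supremum includes a nonnegative value. *)
have m0 : @matnorm R p q E 1 0 <= 1.
  rewrite -(@expr_le1 _ 2) ?matnorm_ge0//; apply: sqr_matnorm_le => // x.
  rewrite mul1r /blocksq big1 => [|i _].
    by do 2!apply: sumr_ge0 => ? _; exact: sqnormc_ge0.
  apply: big1 => a _; rewrite big1 ?sqnormc0// => j _.
  by apply: big1 => t _; rewrite [X in vsval X]mxE (linear0 vsval) mxE mul0r.
apply: (@le_trans _ _ (matnorm (map_mx u (0 : 'M_1)))%:E).
  by rewrite lee_fin matnorm_ge0.
exact: cbnorm_ge.
Qed.

End CbNorm.
End OperatorNorm.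

(** * Families of matrices with disjoint supports and unimodular entries *)

Record incidence (R : realType) (n p q : nat) (b : 'I_n -> 'M[R[i]]_(p, q))
    (P : 'I_n -> 'I_p -> 'I_q -> bool) (alpha beta gamma : nat) : Prop := {
  inc_norm : forall i a t, ComplexField.Normc.normc (b i a t) = (P i a t)%:R;
  inc_uniq : forall i j a t, P i a t -> P j a t -> i = j;
  inc_row1 : forall i a, (\sum_t P i a t <= 1)%N;
  inc_col1 : forall i t, (\sum_a P i a t <= 1)%N;
  inc_row : forall a, (\sum_i \sum_t P i a t = alpha)%N;
  inc_col : forall t, (\sum_i \sum_a P i a t = beta)%N;
  inc_supp : forall i, (\sum_a \sum_t P i a t = gamma)%N
}.

Section Incidence.
Variables (R : realType) (n p q : nat) (b : 'I_n -> 'M[R[i]]_(p, q)).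
Variables (P : 'I_n -> 'I_p -> 'I_q -> bool) (alpha beta gamma : nat).
Hypothesis incb : incidence b P alpha beta gamma.
Local Notation C := R[i].

Lemma inc_sqnormc i a t : sqnormc (b i a t) = (P i a t)%:R.
Proof. by rewrite /sqnormc (inc_norm incb) -natrX; case: P. Qed.

Lemma inc_eq0 i a t : ~~ P i a t -> b i a t = 0.
Proof.
move=> /negPf h; apply: ComplexField.Normc.eq0_normc.
by rewrite (inc_norm incb) h.
Qed.

Lemma inc_card_rows : (n * gamma = p * alpha)%N.
Proof.
transitivity (\sum_i \sum_a \sum_t P i a t)%N.
  by under eq_bigr do rewrite (inc_supp incb); rewrite sum_nat_const card_ord.
rewrite exchange_big /=; under eq_bigr do rewrite (inc_row incb).
by rewrite sum_nat_const card_ord.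
Qed.

Lemma inc_card_cols : (n * gamma = q * beta)%N.
Proof.
transitivity (\sum_i \sum_t \sum_a P i a t)%N.
  under [RHS]eq_bigr do rewrite exchange_big (inc_supp incb).
  by rewrite sum_nat_const card_ord.
rewrite exchange_big /=; under eq_bigr do rewrite (inc_col incb).
by rewrite sum_nat_const card_ord.
Qed.

(* Cauchy-Schwarz with weights P, using that |c j| = |c j|^2. *)
Lemma weighted_CauchySchwarz (J : finType) (c y : J -> C) (Q : J -> bool) :
  (forall j, ComplexField.Normc.normc (c j) = (Q j)%:R) ->
  sqnormc (\sum_j c j * y j) <=
  (\sum_j Q j)%N%:R * \sum_j (Q j)%:R * sqnormc (y j).
Proof.
move=> hc.
have hQ j : sqnormc (c j) = (Q j)%:R by rewrite /sqnormc hc -natrX; case: (Q j).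
have -> : \sum_j c j * y j = \sum_j c j * ((Q j)%:R * y j).
  apply: eq_bigr => j _; have := hc j; case: (Q j) => h; rewrite ?mul1r//.
  by rewrite (ComplexField.Normc.eq0_normc h) !mul0r.
apply: le_trans (sqnormc_sum_le _ _) _.
rewrite natr_sum -(eq_bigr _ (fun j _ => hQ j)).
apply: ler_wpM2l; first by apply: sumr_ge0 => j _; exact: sqnormc_ge0.
apply: ler_sum => j _; rewrite sqnormcM.
by case: (Q j); rewrite ?sqnormc0 ?sqnormc1.
Qed.

(** The row (b_1, ..., b_n) has norm at most sqrt alpha: each of its rows has [alpha] nonzero
    entries, and each of its columns at most one. *)
Lemma inc_row_bound (y : 'I_n -> 'I_q -> C) :
  \sum_a sqnormc (\sum_i \sum_t b i a t * y i t) <=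
  alpha%:R * \sum_i \sum_t sqnormc (y i t).
Proof.
have h a : sqnormc (\sum_i \sum_t b i a t * y i t) <=
    alpha%:R * \sum_i \sum_t (P i a t)%:R * sqnormc (y i t).
  rewrite pair_big /= (pair_big xpredT xpredT) /=.
  have := weighted_CauchySchwarz (c := fun ij : 'I_n * 'I_q => b ij.1 a ij.2)
    (fun ij => y ij.1 ij.2) (Q := fun ij => P ij.1 a ij.2).
  rewrite -(pair_big xpredT xpredT (fun i t => nat_of_bool (P i a t))) /=.
  by rewrite (inc_row incb); apply => ij; exact: (inc_norm incb).
apply: le_trans (ler_sum _ (fun a _ => h a)) _.
rewrite -mulr_sumr; apply: ler_wpM2l; first exact: ler0n.
rewrite exchange_big /=; apply: ler_sum => i _.
rewrite exchange_big /=; apply: ler_sum => t _.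
rewrite -mulr_suml -natr_sum ler_piMl ?sqnormc_ge0//.
by rewrite (ler_nat _ _ 1) (inc_col1 incb).
Qed.

(** The column (b_1, ..., b_n) has norm at most sqrt beta: each of its rows has at most one nonzero
    entry, and each of its columns has [beta]. *)
Lemma inc_col_bound (x : 'I_q -> C) :
  \sum_i \sum_a sqnormc (\sum_t b i a t * x t) <=
  beta%:R * \sum_t sqnormc (x t).
Proof.
have h i a : sqnormc (\sum_t b i a t * x t) <=
    \sum_t (P i a t)%:R * sqnormc (x t).
  apply: le_trans (weighted_CauchySchwarz _ _) _.
    by move=> t; exact: (inc_norm incb).
  rewrite ler_piMl//; last by rewrite (ler_nat _ _ 1) (inc_row1 incb).
  by apply: sumr_ge0 => t _; rewrite mulr_ge0 ?ler0n ?sqnormc_ge0.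
apply: (le_trans (ler_sum _ (fun i _ => ler_sum _ (fun a _ => h i a)))).
under eq_bigr do rewrite exchange_big /=.
rewrite exchange_big /= mulr_sumr; apply: ler_sum => t _.
rewrite -(inc_col incb t) natr_sum mulr_suml; apply: ler_sum => i _.
by rewrite natr_sum mulr_suml.
Qed.

(** Disjoint supports make the b_i orthogonal for the Hilbert-Schmidt inner product, each of squared
    norm [gamma]. *)
Lemma inc_HS (y : 'I_n -> C) :
  \sum_a \sum_t sqnormc (\sum_i y i * b i a t) =
  gamma%:R * \sum_i sqnormc (y i).
Proof.
have h a t : sqnormc (\sum_i y i * b i a t) =
    \sum_i sqnormc (y i) * (P i a t)%:R.
  have [i /= Pi|/= noP] := pickP (fun i => P i a t); last first.
    rewrite !big1 ?sqnormc0// => i _; first by rewrite noP mulr0.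
    by rewrite inc_eq0 ?mulr0// noP.
  rewrite (bigD1 i)//= big1 => [|j ji].
    rewrite (bigD1 i)//= big1 => [|j ji].
      by rewrite !addr0 sqnormcM inc_sqnormc Pi.
    case Pj: (P j a t); last by rewrite mulr0.
    by rewrite (inc_uniq incb Pj Pi) eqxx in ji.
  case Pj: (P j a t); last by rewrite inc_eq0 ?mulr0// Pj.
  by rewrite (inc_uniq incb Pj Pi) eqxx in ji.
under eq_bigr do under eq_bigr do rewrite h.
under eq_bigr do rewrite exchange_big /=.
rewrite exchange_big /= mulr_sumr; apply: eq_bigr => i _.
rewrite -(inc_supp incb i) mulrC natr_sum mulr_sumr; apply: eq_bigr => a _.
by rewrite natr_sum mulr_sumr.
Qed.

End Incidence.

(** * Coordinates in the span of a finite family *)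

Section Span.
Variables (K : fieldType) (vT : vectType K) (n : nat) (b : 'I_n -> vT).

(** Spelled as in [H], so that [H n R k] is [spanf (bvec R k)] by conversion. *)
Definition spanf : {vspace vT} := <<[seq b i | i : 'I_n]>>%VS.

Lemma spanf_tuple : spanf = <<[tuple b i | i < n]>>%VS.
Proof. by []. Qed.

Definition spanf_gen (i : 'I_n) : subvs_of spanf := vsproj spanf (b i).

Lemma vsval_gen i : vsval (spanf_gen i) = b i.
Proof. by rewrite vsprojK// memv_span// map_f// mem_enum. Qed.

Definition spanf_coord (w : subvs_of spanf) (i : 'I_n) : K :=
  coord [tuple b i | i < n] i (vsval w).

Lemma vsval_coord w : vsval w = \sum_i spanf_coord w i *: b i.
Proof.
rewrite {1}(@coord_span _ _ _ [tuple b i | i < n] (vsval w)); last first.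
  by rewrite -spanf_tuple subvsP.
by apply: eq_bigr => i _; rewrite (nth_mktuple b 0 i).
Qed.

Lemma spanf_coordE w : w = \sum_i spanf_coord w i *: spanf_gen i.
Proof.
apply: val_inj; rewrite /= vsval_coord linear_sum /=; apply: eq_bigr => i _.
by rewrite vsval_gen.
Qed.

Definition spanf_lift (V : vectType K) (x : 'I_n -> V) (w : subvs_of spanf) : V :=
  \sum_i spanf_coord w i *: x i.

Lemma spanf_lift_is_linear V x : linear (@spanf_lift V x).
Proof.
move=> c v w; rewrite /spanf_lift scaler_sumr -big_split /=.
apply: eq_bigr => i _.
by rewrite /spanf_coord !linearP /= scalerDl scalerA.
Qed.

HB.instance Definition _ (V : vectType K) (x : 'I_n -> V) :=
  GRing.isLinear.Build K (subvs_of spanf) V _ (@spanf_lift V x)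
    (spanf_lift_is_linear x).

Hypothesis free_b : forall c : 'I_n -> K, \sum_i c i *: b i = 0 -> forall i, c i = 0.

Lemma spanf_coord_uniq (w : subvs_of spanf) (c : 'I_n -> K) :
  vsval w = \sum_i c i *: b i -> spanf_coord w =1 c.
Proof.
move=> hw i; apply/eqP; rewrite -subr_eq0; apply/eqP; move: i.
apply: free_b; under eq_bigr do rewrite scalerBl.
by rewrite sumrB -vsval_coord -hw subrr.
Qed.

End Span.

Lemma sum_ord_le {R : numDomainType} m (f : 'I_m -> R) c :
  (forall i, f i <= c) -> \sum_i f i <= m%:R * c.
Proof.
move=> fc; rewrite mulr_natl -[m in leRHS]card_ord -sumr_const.
by apply: ler_sum => i _.
Qed.

(** A vanishing combination has zero Hilbert-Schmidt norm, which by [inc_HS] is [gamma] times the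
    sum of the squared coefficients. *)
Lemma inc_free (R : realType) (n p q : nat) (b : 'I_n -> 'M[R[i]]_(p, q)) P
    alpha beta gamma (c : 'I_n -> R[i]) :
  incidence b P alpha beta gamma -> (0 < gamma)%N ->
  \sum_i c i *: b i = 0 -> forall i, c i = 0.
Proof.
move=> incb g0 hc i.
have : gamma%:R * \sum_i sqnormc (c i) = 0.
  rewrite -(inc_HS incb) big1// => a _; rewrite big1// => t _.
  rewrite -[RHS](@sqnormc0 R); congr sqnormc.
  have /matrixP/(_ a t) := hc; rewrite summxE mxE => hat; rewrite -[RHS]hat.
  by apply: eq_bigr => j _; rewrite mxE.
move/eqP; rewrite mulf_eq0 pnatr_eq0 eqn0Ngt g0 /= => /eqP/psumr_eq0P.
move=> /(_ (fun i _ => sqnormc_ge0 _) i isT)/eqP.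
by rewrite sqrf_eq0 => /eqP/ComplexField.Normc.eq0_normc.
Qed.

(** * Upper and lower bounds for completely bounded norms *)

Section CbEstimates.
Variables (R : realType) (n p q p' q' : nat).
Local Notation C := R[i].
Variables (b : 'I_n -> 'M[C]_(p, q)) (b' : 'I_n -> 'M[C]_(p', q')).
Variables (P : 'I_n -> 'I_p -> 'I_q -> bool) (P' : 'I_n -> 'I_p' -> 'I_q' -> bool).
Variables (alpha beta gamma alpha' beta' gamma' : nat).
Hypotheses (incb : incidence b P alpha beta gamma).
Hypotheses (incb' : incidence b' P' alpha' beta' gamma').
Hypothesis gamma_gt0 : (0 < gamma)%N.

Definition gen_map : 'Hom(subvs_of (spanf b), subvs_of (spanf b')) :=
  linfun (spanf_lift (b := b) (spanf_gen b')).

Lemma vsval_gen_map w : vsval (gen_map w) = \sum_i spanf_coord w i *: b' i.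
Proof.
rewrite lfunE /= /spanf_lift linear_sum /=.
by apply: eq_bigr => i _; rewrite vsval_gen.
Qed.

(** Write X as the sum of y_i (x) b_i. The column of the y_i has squared norm at most q / gamma, and
    the row of the b'_i at most alpha'; the image of X is the product of such a row and column.
    Applied in both directions, this gives both upper bounds. *)
Lemma cbnorm_gen_map_le :
  (cbnorm gen_map <= (Num.sqrt (alpha'%:R * q%:R / gamma%:R))%:E)%E.
Proof.
apply: cbnorm_le => m X hX.
have c0 : 0 <= alpha'%:R * q%:R / gamma%:R :> R.
  by rewrite !mulr_ge0 ?invr_ge0 ?ler0n.
rewrite -(@ler_pXn2r _ 2)// ?nnegrE ?sqrtr_ge0 ?matnorm_ge0// sqr_sqrtr//.
apply: sqr_matnorm_le => // x.
pose y r s i := spanf_coord (X r s) i.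
have step1 (z : 'I_m -> C) :
    \sum_r \sum_i sqnormc (\sum_s y r s i * z s) <=
    q%:R / gamma%:R * \sum_s sqnormc (z s).
  rewrite -mulrA mulrCA ler_pdivlMl ?ltr0n// mulr_sumr.
  under eq_bigr do rewrite -(inc_HS incb) exchange_big /=.
  rewrite exchange_big /=; apply: sum_ord_le => t0.
  (* Test on z (x) e_t0; summing over the q choices of [t0] recovers the Hilbert-Schmidt norm of
     [inc_HS]. *)
  have := blocksq_le X (fun s t => z s * (t == t0)%:R).
  have sum1 s : \sum_(t < q) sqnormc (z s * (t == t0)%:R) = sqnormc (z s).
    rewrite (bigD1 t0)//= eqxx mulr1 big1 ?addr0// => t /negPf ->.
    by rewrite mulr0 sqnormc0.
  rewrite [in leRHS](eq_bigr _ (fun s _ => sum1 s)) => h.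
  apply: le_trans (le_trans _ h) _; last first.
    rewrite ler_piMl ?exprn_ile1 ?matnorm_ge0//.
    by apply: sumr_ge0 => s _; exact: sqnormc_ge0.
  rewrite le_eqVlt; apply/orP; left; apply/eqP.
  apply: eq_bigr => r _; apply: eq_bigr => a _; congr sqnormc.
  under eq_bigr do rewrite mulr_suml.
  rewrite exchange_big /=; apply: eq_bigr => s _.
  rewrite [RHS](bigD1 t0)//= eqxx mulr1 [X in _ + X]big1 => [|t /negPf ->].
    rewrite addr0.
    rewrite vsval_coord summxE mulr_suml; apply: eq_bigr => i _.
    by rewrite mxE mulrAC.
  by rewrite !mulr0.
have -> : blocksq (map_mx gen_map X) x =
    \sum_r \sum_a sqnormc (\sum_i \sum_t b' i a t * \sum_s y r s i * x s t).
  apply: eq_bigr => r _; apply: eq_bigr => a _; congr sqnormc.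
  transitivity (\sum_s \sum_i \sum_t b' i a t * (y r s i * x s t)).
    apply: eq_bigr => s _; rewrite exchange_big /=; apply: eq_bigr => t _.
    rewrite mxE vsval_gen_map summxE mulr_suml; apply: eq_bigr => i _.
    by rewrite mxE mulrA [b' i a t * _]mulrC.
  rewrite exchange_big /=; apply: eq_bigr => i _.
  rewrite exchange_big /=; apply: eq_bigr => t _.
  by rewrite mulr_sumr.
apply: le_trans (ler_sum _ (fun r _ => inc_row_bound incb' _)) _.
rewrite -mulr_sumr -!mulrA ler_wpM2l ?ler0n//.
under eq_bigr do rewrite exchange_big /=.
(* With the sum over [t] outermost, [step1] applies to each vector (x s t)_s. *)
rewrite exchange_big /= [X in _ <= _ * (_ * X)]exchange_big /= mulrA mulr_sumr.
by apply: ler_sum => t _; exact: step1.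
Qed.

Variable u : 'Hom(subvs_of (spanf b), subvs_of (spanf b')).

Definition hom_coef (i j : 'I_n) : C := spanf_coord (u (spanf_gen b i)) j.

Lemma vsval_hom_gen (c : C) i a t : vsval (u (c *: spanf_gen b i)) a t =
  c * \sum_j hom_coef i j * b' j a t.
Proof.
rewrite linearZ /= mxE vsval_coord summxE; congr (_ * _).
by apply: eq_bigr => j _; rewrite mxE.
Qed.

Lemma vsval_scale_gen (c : C) i a t :
  vsval (c *: spanf_gen b i) a t = c * b i a t.
Proof. by rewrite linearZ /= mxE vsval_gen. Qed.

(* The test element is the column (b_1, ..., b_n), placed in column s0. *)
Lemma cbnorm_ge_col : (0 < n)%N -> (0 < beta)%N -> (0 < q')%N ->
  ((Num.sqrt (gamma'%:R * (\sum_i \sum_j sqnormc (hom_coef i j))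
              / (q'%:R * beta%:R)))%:E <= cbnorm u)%E.
Proof.
move=> n0 b0 q0; pose s0 := Ordinal n0.
(* By [inc_col_bound] this scalar brings the column into the unit ball; zeros pad it to a square
   matrix. *)
pose c : C := (Num.sqrt (beta%:R : R))^-1%:C%C.
have c2 : sqnormc c = beta%:R^-1 by rewrite sqnormc_real exprVn sqr_sqrtr ?ler0n.
pose X : 'M[subvs_of (spanf b)]_n :=
  \matrix_(r, s) if s == s0 then c *: spanf_gen b r else 0.
have hX : matnorm X <= 1.
  rewrite -(@expr_le1 _ 2) ?matnorm_ge0//; apply: sqr_matnorm_le => // x.
  rewrite mul1r.
  have -> : blocksq X x =
      beta%:R^-1 * \sum_r \sum_a sqnormc (\sum_t b r a t * x s0 t).
    rewrite mulr_sumr; apply: eq_bigr => r _; rewrite mulr_sumr.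
    apply: eq_bigr => a _; rewrite -c2 -sqnormcM; congr sqnormc.
    rewrite (bigD1 s0)//= [X in _ + X]big1 ?addr0 => [|s /negPf ns].
      rewrite mulr_sumr; apply: eq_bigr => t _.
      by rewrite mxE eqxx vsval_scale_gen mulrA.
    by apply: big1 => t _; rewrite mxE ns (linear0 vsval) mxE mul0r.
  rewrite ler_pdivrMl ?ltr0n//; apply: le_trans (inc_col_bound incb _) _.
  rewrite ler_wpM2l ?ler0n// [leRHS](bigD1 s0)//= lerDl.
  by do 2!apply: sumr_ge0 => ? _; exact: sqnormc_ge0.
apply: (@le_trans _ _ (matnorm (map_mx u X))%:E); last exact: cbnorm_ge.
rewrite lee_fin -(@ler_pXn2r _ 2)// ?nnegrE ?sqrtr_ge0 ?matnorm_ge0//.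
have S0 : 0 <= \sum_i \sum_j sqnormc (hom_coef i j).
  by do 2!apply: sumr_ge0 => ? _; exact: sqnormc_ge0.
rewrite sqr_sqrtr ?mulr_ge0 ?invr_ge0 ?mulr_ge0 ?ler0n//.
(* By [inc_HS] this is the average, over the q' columns of block column [s0] of the image, of their
   squared norms; [matnorm_col] bounds each one. *)
have -> : gamma'%:R * (\sum_i \sum_j sqnormc (hom_coef i j)) / (q'%:R * beta%:R)
   = q'%:R^-1 * \sum_(t < q') \sum_r \sum_a sqnormc (vsval (map_mx u X r s0) a t).
  rewrite mulrC invfM -mulrA; congr (_ * _).
  rewrite !mulr_sumr [RHS]exchange_big /=; apply: eq_bigr => r _.
  rewrite [RHS]exchange_big /= -(inc_HS incb') mulr_sumr; apply: eq_bigr => a _.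
  rewrite mulr_sumr; apply: eq_bigr => t _.
  by rewrite !mxE eqxx vsval_hom_gen sqnormcM c2.
rewrite ler_pdivrMl ?ltr0n//.
by apply: sum_ord_le => t; exact: matnorm_col.
Qed.

(* The test element is the row (b_1, ..., b_n), placed in row r0. *)
Lemma cbnorm_ge_row : (0 < n)%N -> (0 < alpha)%N -> (0 < p')%N ->
  ((Num.sqrt (gamma'%:R * (\sum_i \sum_j sqnormc (hom_coef i j))
              / (p'%:R * alpha%:R)))%:E <= cbnorm u)%E.
Proof.
move=> n0 a0 p0; pose r0 := Ordinal n0.
pose c : C := (Num.sqrt (alpha%:R : R))^-1%:C%C.
have c2 : sqnormc c = alpha%:R^-1 by rewrite sqnormc_real exprVn sqr_sqrtr ?ler0n.
pose X : 'M[subvs_of (spanf b)]_n :=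
  \matrix_(r, s) if r == r0 then c *: spanf_gen b s else 0.
have hX : matnorm X <= 1.
  rewrite -(@expr_le1 _ 2) ?matnorm_ge0//; apply: sqr_matnorm_le => // x.
  rewrite mul1r.
  have -> : blocksq X x =
      alpha%:R^-1 * \sum_a sqnormc (\sum_s \sum_t b s a t * x s t).
    rewrite /blocksq (bigD1 r0)//= [X in _ + X]big1 ?addr0 => [|r /negPf nr].
      rewrite mulr_sumr; apply: eq_bigr => a _; rewrite -c2 -sqnormcM.
      congr sqnormc; rewrite mulr_sumr; apply: eq_bigr => s _.
      rewrite mulr_sumr; apply: eq_bigr => t _.
      by rewrite mxE eqxx vsval_scale_gen mulrA.
    apply: big1 => a _; rewrite big1 ?sqnormc0// => s _; apply: big1 => t _.
    by rewrite mxE nr (linear0 vsval) mxE mul0r.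
  by rewrite ler_pdivrMl ?ltr0n//; exact: inc_row_bound incb _.
apply: (@le_trans _ _ (matnorm (map_mx u X))%:E); last exact: cbnorm_ge.
rewrite lee_fin -(@ler_pXn2r _ 2)// ?nnegrE ?sqrtr_ge0 ?matnorm_ge0//.
have S0 : 0 <= \sum_i \sum_j sqnormc (hom_coef i j).
  by do 2!apply: sumr_ge0 => ? _; exact: sqnormc_ge0.
rewrite sqr_sqrtr ?mulr_ge0 ?invr_ge0 ?mulr_ge0 ?ler0n//.
(* Dually, an average over the p' rows of block row [r0], each bounded by [matnorm_row]. *)
have -> : gamma'%:R * (\sum_i \sum_j sqnormc (hom_coef i j)) / (p'%:R * alpha%:R)
   = p'%:R^-1 * \sum_(a < p') \sum_s \sum_t sqnormc (vsval (map_mx u X r0 s) a t).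
  rewrite mulrC invfM -mulrA; congr (_ * _).
  rewrite !mulr_sumr.
  under eq_bigr do rewrite -(inc_HS incb') mulr_sumr.
  rewrite exchange_big /=; apply: eq_bigr => a _; apply: eq_bigr => s _.
  rewrite mulr_sumr; apply: eq_bigr => t _.
  by rewrite !mxE eqxx vsval_hom_gen sqnormcM c2.
rewrite ler_pdivrMl ?ltr0n//.
by apply: sum_ord_le => a; exact: matnorm_row.
Qed.

End CbEstimates.

(** * Combinatorics of the supports of the b_i *)

Section Words.
Variable n : nat.
Implicit Types (I J : {set 'I_n}) (i : 'I_n).

Definition splits I i J : bool :=
  (I :&: J == finset.set0) && (~: (I :|: J) == [set i]).

Lemma splitsC I i J : splits I i J = splits J i I.
Proof. by rewrite /splits setIC setUC. Qed.

Lemma splitsE I i J : splits I i J = (i \notin J) && (I == ~: (i |: J)).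
Proof.
apply/idP/idP => [/andP[/eqP IJ /eqP ID]|/andP[iJ /eqP ->]]; last first.
  apply/andP; split; apply/eqP/setP => x; rewrite !inE.
    by case: (x \in J); rewrite ?orbT ?andbF.
  case: (eqVneq x i) => [->|_] /=; first by rewrite (negPf iJ).
  by case: (x \in J).
have h x : (x == i) = ~~ ((x \in I) || (x \in J)).
  by have /setP/(_ x) := ID; rewrite !inE => <-.
have hi : ~~ ((i \in I) || (i \in J)) by rewrite -h.
apply/andP; split; first by case/norP: hi.
apply/eqP/setP => x; rewrite !inE h.
have /setP/(_ x) := IJ; rewrite !inE.
by case: (x \in I); case: (x \in J).
Qed.

Lemma splits_uniq I i j J : splits I i J -> splits I j J -> i = j.
Proof. by move=> /andP[_ /eqP h] /andP[_ /eqP]; rewrite h => /set1_inj. Qed.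

(** The word lists every ordinal exactly once, so a sorting permutation exists and the default value
    0 of [eps] is not taken. *)
Lemma normc_eps (R : realType) I i J : splits I i J ->
  ComplexField.Normc.normc (eps R I i J) = 1.
Proof.
rewrite /eps => sp.
have hs : exists s : 'S_n, map s (enum I ++ i :: enum J) == enum 'I_n.
  have /tuple_permP[s hs] : perm_eq (enum I ++ i :: enum J) (ord_tuple n).
    rewrite val_ord_tuple; apply: uniq_perm; rewrite ?enum_uniq//.
      move: sp; rewrite splitsE => /andP[iJ /eqP ->].
      rewrite cat_uniq /= !enum_uniq !mem_enum !inE negb_or eqxx iJ /= !andbT.
      apply/hasPn => x; rewrite !mem_enum !inE => ->; by rewrite orbT.
    move=> x; rewrite mem_cat inE !mem_enum.
    move: sp; rewrite splitsE => /andP[iJ /eqP ->].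
    by rewrite !inE; case: (x == i); case: (x \in J).
  (* [s] sends the sorted list to the word; its inverse sorts the word. *)
  exists (s^-1)%g; rewrite hs -map_comp; apply/eqP.
  rewrite -[RHS]map_id val_ord_tuple; apply: eq_map => x /=.
  by rewrite tnth_ord_tuple permK.
case: pickP => [s _|no]; last by case: hs => s; rewrite no.
elim: (odd_perm s : nat) => [|m IHm]; rewrite ?expr0 ?exprS.
  exact: ComplexField.Normc.normc1.
rewrite ComplexField.Normc.normcM IHm mulr1 /=.
by rewrite oppr0 expr0n addr0 sqrrN expr1n sqrtr1.
Qed.

Lemma mem_lexsets m A : (A \in lexsets n m) = (#|A| == m).
Proof. by rewrite mem_sort mem_enum inE. Qed.

Lemma size_lexsets m : size (lexsets n m) = 'C(n, m).
Proof. by rewrite size_sort -cardE card_draws card_ord. Qed.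

Lemma card_nth_lexsets m (a : 'I_('C(n, m))) :
  #|nth finset.set0 (lexsets n m) a| = m.
Proof. by apply/eqP; rewrite -mem_lexsets mem_nth// size_lexsets. Qed.

Lemma sum_lexsets m (F : {set 'I_n} -> nat) :
  (\sum_(a < 'C(n, m)) F (nth finset.set0 (lexsets n m) a) =
   \sum_(A : {set 'I_n} | #|A| == m) F A)%N.
Proof.
rewrite -size_lexsets -(big_mkord xpredT (fun a => F (nth _ _ a))).
rewrite -(big_nth finset.set0 xpredT F) (perm_big (enum [set A : {set 'I_n} | #|A| == m])).
  by rewrite big_enum /=; apply: eq_bigl => A; rewrite inE.
by rewrite perm_sort.
Qed.

(** The only candidate is the complement of i |: J, which has [m] elements when i is outside J. *)
Lemma sum_splits m J i : (m + #|J|).+1 = n ->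
  (\sum_(a < 'C(n, m)) splits (nth finset.set0 (lexsets n m) a) i J
   = (i \notin J))%N.
Proof.
move=> hm; rewrite (sum_lexsets m (fun A => splits A i J)).
rewrite (eq_bigr (fun A => ((i \notin J) && (A == ~: (i |: J))) : nat)) => [|A _].
  have [iJ|iJ] := boolP (i \in J); first by rewrite big1.
  rewrite (bigD1 (~: (i |: J))) /=; last first.
    by rewrite cardsCs setCK card_ord cardsU1 iJ /= -{1}hm add1n subSS addnK.
  by rewrite eqxx big1 // => A /andP[_ /negPf ->].
by rewrite splitsE.
Qed.

End Words.

Definition bsupp n k (i : 'I_n) (a : 'I_('C(n, n - k))) (t : 'I_('C(n, k - 1))) :=
  splits (nth finset.set0 (lexsets n (k - 1)) t) i
         (nth finset.set0 (lexsets n (n - k)) a).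

Lemma bvecE (R : realType) n k (i : 'I_n) a t : bvec R k i a t =
  if bsupp i a t then eps R (nth finset.set0 (lexsets n (k - 1)) t) i
                          (nth finset.set0 (lexsets n (n - k)) a) else 0.
Proof.
rewrite summxE (bigD1 a)//= [X in _ + X]big1 => [|a' /negPf na]; last first.
  by rewrite summxE big1// => t' _; rewrite !mxE eq_sym na mulr0.
rewrite addr0 summxE big_mkcond /= (bigD1 t)//= big1 => [|t' /negPf nt].
  rewrite addr0 /bsupp /splits; case: ifP => //= _.
  by rewrite !mxE !eqxx mulr1.
by case: ifP => // _; rewrite !mxE [t == _]eq_sym nt andbF mulr0.
Qed.

Lemma card_notin n (A : {set 'I_n}) : (\sum_i (i \notin A) = n - #|A|)%N.
Proof.
have <- : #|~: A| = (n - #|A|)%N by rewrite cardsCs setCK card_ord.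
rewrite -sum1_card [RHS]big_mkcond /=.
by apply: eq_bigr => i _; rewrite inE; case: (i \in A).
Qed.

(** In row J the entries correspond to the k elements i outside J, in column I to the n - k + 1
    elements outside I; the entries of b_i correspond to the (k - 1)-subsets of the complement of
    i. *)
Lemma incidence_bvec (R : realType) n k : (0 < k <= n)%N ->
  incidence (bvec (n := n) R k) (@bsupp n k) k (n - k + 1) 'C(n.-1, k.-1).
Proof.
move=> /andP[k0 kn].
have sumt i (a : 'I_('C(n, n - k))) : (\sum_t @bsupp n k i a t =
    (i \notin nth finset.set0 (lexsets n (n - k)) a))%N.
  by rewrite sum_splits// card_nth_lexsets; lia.
have suma i (t : 'I_('C(n, k - 1))) : (\sum_a @bsupp n k i a t =
    (i \notin nth finset.set0 (lexsets n (k - 1)) t))%N.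
  under eq_bigr do rewrite /bsupp splitsC.
  by rewrite sum_splits// card_nth_lexsets; lia.
split.
- move=> i a t; rewrite bvecE; case: ifP => h; first by rewrite normc_eps.
  exact: ComplexField.Normc.normc0.
- move=> i j a t; exact: splits_uniq.
- by move=> i a; rewrite sumt; case: (i \notin _).
- by move=> i t; rewrite suma; case: (i \notin _).
- move=> a; under eq_bigr do rewrite sumt.
  by rewrite card_notin card_nth_lexsets; lia.
- move=> t; under eq_bigr do rewrite suma.
  by rewrite card_notin card_nth_lexsets; lia.
move=> i; rewrite exchange_big /=; under eq_bigr do rewrite suma.
rewrite (sum_lexsets (k - 1) (fun A => i \notin A)).
have -> : 'C(n.-1, k.-1) = 'C(#|[set~ i]|, k - 1).
  by rewrite cardsC1 card_ord subn1.
rewrite -cards_draws -sum1_card big_mkcond [RHS]big_mkcond /=.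
apply: eq_bigr => A _; rewrite inE subsetC sub1set inE.
by case: (i \in A); case: (_ == _).
Qed.

(** * The distance to the column space *)

Section Distance.
Variables (R : realType) (n p q p' q' : nat).
Local Notation C := R[i].
Variables (b : 'I_n -> 'M[C]_(p, q)) (b' : 'I_n -> 'M[C]_(p', q')).
Variables (P : 'I_n -> 'I_p -> 'I_q -> bool) (P' : 'I_n -> 'I_p' -> 'I_q' -> bool).
Variables (alpha beta gamma alpha' beta' gamma' : nat).
Hypotheses (incb : incidence b P alpha beta gamma).
Hypotheses (incb' : incidence b' P' alpha' beta' gamma').

Lemma gen_mapK : (0 < gamma')%N -> cancel (gen_map b b') (gen_map b' b).
Proof.
move=> g0 w; apply: val_inj; rewrite /= vsval_gen_map [RHS]vsval_coord.
apply: eq_bigr => i _; congr (_ *: _); apply: spanf_coord_uniq i.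
  by move=> c; exact: inc_free incb' g0.
exact: vsval_gen_map.
Qed.

(** The diagonal entries of the matrix of v o u = id; their sum is the trace used in
    [HS_inverse]. *)
Lemma hom_coef_inverse (u : 'Hom(subvs_of (spanf b), subvs_of (spanf b')))
    (v : 'Hom(subvs_of (spanf b'), subvs_of (spanf b))) i : (0 < gamma)%N ->
  cancel u v -> \sum_j hom_coef u i j * hom_coef v j i = 1.
Proof.
move=> g0 uK.
have free_b c := inc_free (c := c) incb g0.
pose w := spanf_gen b i.
have h1 : spanf_coord w i = 1.
  rewrite (spanf_coord_uniq free_b (c := fun l => (l == i)%:R)) ?eqxx//.
  rewrite vsval_gen (bigD1 i)//= eqxx scale1r big1 ?addr0// => l /negPf ->.
  by rewrite scale0r.
rewrite -h1 (spanf_coord_uniq free_b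
  (c := fun l => \sum_j hom_coef u i j * hom_coef v j l))//.
rewrite -[w]uK [u w]spanf_coordE linear_sum linear_sum /=.
under [RHS]eq_bigr do rewrite scaler_suml.
rewrite [RHS]exchange_big /=; apply: eq_bigr => j _.
rewrite !linearZ /= vsval_coord scaler_sumr; apply: eq_bigr => l _.
by rewrite scalerA.
Qed.

Lemma HS_inverse (u : 'Hom(subvs_of (spanf b), subvs_of (spanf b')))
    (v : 'Hom(subvs_of (spanf b'), subvs_of (spanf b))) : (0 < gamma)%N ->
  cancel u v -> n%:R ^+ 2 <= (\sum_i \sum_j sqnormc (hom_coef u i j)) *
                             (\sum_i \sum_j sqnormc (hom_coef v i j)).
Proof.
move=> g0 uK; rewrite [X in _ <= _ * X]exchange_big /= !pair_big /=.
apply: le_trans (sqnormc_sum_le _ _).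
rewrite -(pair_big xpredT xpredT (fun i j => hom_coef u i j * hom_coef v j i)) /=.
under eq_bigr do rewrite (hom_coef_inverse _ g0 uK).
by rewrite sumr_const card_ord -(rmorph_nat (real_complex R)) sqnormc_real.
Qed.

End Distance.

(** The second family models the column space. Its width [q'] is constrained by an equation because
    for [H n R 1] it reads 'C(n, 1 - 1). *)
Lemma dcb_incidence_column (R : realType) (n p q p' q' : nat)
    (b : 'I_n -> 'M[R[i]]_(p, q)) (b' : 'I_n -> 'M[R[i]]_(p', q')) P P'
    alpha beta gamma : (0 < n)%N -> (0 < alpha)%N -> (0 < beta)%N ->
  (0 < gamma)%N -> q' = 1%N ->
  incidence b P alpha beta gamma -> incidence b' P' 1 n 1 ->
  dcb (spanf b) (spanf b') = (Num.sqrt (alpha%:R * n%:R / beta%:R))%:E.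
Proof.
move=> n0 a0 b0 g0 q1 incb incb'.
have rows := inc_card_rows incb; have cols := inc_card_cols incb.
have p0 : (0 < p)%N.
  have : (0 < p * alpha)%N by rewrite -rows muln_gt0 n0.
  by rewrite muln_gt0 => /andP[].
have bR : beta%:R != 0 :> R by rewrite pnatr_eq0 -lt0n.
have gR : gamma%:R != 0 :> R by rewrite pnatr_eq0 -lt0n.
have pR : p%:R != 0 :> R by rewrite pnatr_eq0 -lt0n.
have rowsR : n%:R * gamma%:R = p%:R * alpha%:R :> R by rewrite -!natrM rows.
have colsR : n%:R * gamma%:R = q%:R * beta%:R :> R by rewrite -!natrM cols.
apply/eqP; rewrite eq_le; apply/andP; split.
  have hu := cbnorm_gen_map_le incb incb' g0.
  have hv := cbnorm_gen_map_le incb' incb isT.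
  apply: (@le_trans _ _ (cbnorm (gen_map b b') * cbnorm (gen_map b' b))%E).
    apply: ereal_inf_lbound; exists (gen_map b b'), (gen_map b' b); split => //.
    - exact: gen_mapK incb' _.
    - exact: gen_mapK incb _.
    - exact: le_lt_trans hu (ltry _).
    - exact: le_lt_trans hv (ltry _).
  apply: (@le_trans _ _ ((Num.sqrt (1%:R * q%:R / gamma%:R))%:E *
                         (Num.sqrt (alpha%:R * q'%:R / 1%:R))%:E)%E).
    by apply: lee_pmul => //; exact: cbnorm_ge0.
  rewrite -EFinM lee_fin -sqrtrM ?mulr_ge0 ?invr_ge0 ?ler0n//.
  rewrite ler_wsqrtr// q1 le_eqVlt; apply/orP; left; apply/eqP.
  (* Counting entries by columns gives q / gamma = n / beta, so the two upper bounds multiply to the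
     claimed value. *)
  have -> : q%:R = n%:R * gamma%:R / beta%:R :> R by rewrite colsR mulfK.
  by field; rewrite bR gR.
apply: le_ereal_inf_tmp => _ [u [v [uK vK _ _ ->]]].
have q'0 : (0 < q')%N by rewrite q1.
have hu := cbnorm_ge_col incb incb' u n0 b0 q'0.
have hv := cbnorm_ge_row incb' incb v n0 isT p0.
apply: le_trans (lee_pmul _ _ hu hv); rewrite ?lee_fin ?sqrtr_ge0//.
have := HS_inverse incb g0 uK.
set U := \sum_i _; set V := \sum_i _ => UV.
have U0 : 0 <= U by do 2!apply: sumr_ge0 => ? _; exact: sqnormc_ge0.
rewrite -sqrtrM ?mulr_ge0 ?invr_ge0 ?mulr_ge0 ?ler0n//.
apply: ler_wsqrtr; rewrite q1.
have -> : 1%:R * U / (1%:R * beta%:R) * (gamma%:R * V / (p%:R * 1%:R)) =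
    gamma%:R / p%:R / beta%:R * (U * V) by field; rewrite bR pR.
(* Counting entries by rows, n gamma = p alpha, lets the trace inequality [UV] finish with the same
   constant. *)
have -> : alpha%:R * n%:R / beta%:R = gamma%:R / p%:R / beta%:R * n%:R ^+ 2 :> R.
  have -> : alpha%:R = n%:R * gamma%:R / p%:R :> R by rewrite rowsR mulrC mulKf.
  by field; rewrite bR pR.
by apply: ler_wpM2l => //; rewrite !mulr_ge0 ?invr_ge0 ?ler0n.
Qed.

Theorem theorem3 (R : realType) (n k : nat) (hk1 : (1 <= k)%N) (hkn : (k <= n)%N) :
  dcb (H n R k) (H n R 1) =
  (Num.sqrt ((k%:R * n%:R) / (n%:R - k%:R + 1)))%:E.
Proof.
have n0 : (0 < n)%N := leq_trans hk1 hkn.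
have inck : incidence (bvec R k) (@bsupp n k) k (n - k + 1) 'C(n.-1, k.-1).
  by apply: incidence_bvec; rewrite hk1.
have inc1 : incidence (bvec R 1) (@bsupp n 1) 1 n 1.
  by have := @incidence_bvec R n 1 n0; rewrite (bin0 n.-1) subnK.
(* Since k <= n, the real difference agrees with the truncated one in [inck]. *)
rewrite -natrB// natr1 -(addn1 (n - k)).
apply: (dcb_incidence_column n0 hk1 _ _ _ inck inc1).
- by rewrite addn1.
- by rewrite bin_gt0; lia.
by rewrite subnn bin0.
Qed.
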